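(* Let $(\mathcal{X}, d)$ be a metric space, and $(\mu_n)_{n\in\mathbb{N}}$ a sequence in $\mathcal{M}_1(\mathcal{X})$. Denote by $\mathcal{L}:=\bigcap_{n\in\mathbb{N}}\overline{\{\mu_k\}_{k\ge n}}$ the set of possible subsequential limits of $(\mu_n)_{n\in\mathbb{N}}$, where $\overline{\{\mu_k\}_{k\ge n}}$ is the closure of the set $\{\mu_k : k\ge n\}$ in $\mathcal{M}_1(\mathcal{X})$. Then the following are equivalent: (i) $(\mu_n)_{n\in\mathbb{N}}$ is asymptotically tight; (ii) $(\mu_n)_{n\in\mathbb{N}}$ is sequentially tight; (iii) $(\mu_n)_{n\in\mathbb{N}}$ is precompact and $\mathcal{L}$ is tight.
   Context: $\mathcal{M}_1(\mathcal{X})$ denotes the set of Borel probability measures on $\mathcal{X}$, equipped with the topology of weak convergence; $\mu_n\to\mu$ weakly means $\int f\,\mathrm{d}\mu_n\to\int f\,\mathrm{d}\mu$ for every bounded continuous $f:\mathcal{X}\to\mathbb{R}$. A sequence in $\mathcal{M}_1(\mathcal{X})$ is called precompact if every subsequence of it has a further subsequence converging weakly to some element of $\mathcal{M}_1(\mathcal{X})$. Asymptotic tightness: for every $\varepsilon>0$ there exists a compact set $K_\varepsilon\subset\mathcal{X}$ such that any open set $G\subset\mathcal{X}$ containing $K_\varepsilon$ satisfies $\liminf_{n\to\infty}\mu_n(G)\ge 1-\varepsilon$. Sequential tightness: writing $B_x(\delta)=\{y\in\mathcal{X} : d(x,y)<\delta\}$ and $B_A(\delta)=\bigcup_{x\in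 A}B_x(\delta)$, the sequence $(\mu_n)_{n\in\mathbb{N}}$ is sequentially tight if for each $\varepsilon>0$ there exists a collection of compact subsets $(K_\varepsilon^\delta)_{\delta>0}$ of $\mathcal{X}$ such that $\liminf_{n\to\infty}\mu_n\big(B_{K_\varepsilon^\delta}(\delta)\big)\ge 1-\varepsilon$ for every $\varepsilon,\delta>0$, and for every $\varepsilon>0$ the subspace $K_\varepsilon:=\overline{\bigcup_{\delta>0}K_\varepsilon^\delta}\subset\mathcal{X}$ is complete. Tightness: a set $\mathcal{A}\subset\mathcal{M}_1(\mathcal{X})$ is tight if for every $\varepsilon>0$ there exists a compact set $K_\varepsilon\subset\mathcal{X}$ such that $\mu(K_\varepsilon)\ge 1-\varepsilon$ for every $\mu\in\mathcal{A}$. *)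

(* Defs.v *)
From HB Require Import structures.
From mathcomp Require Import all_boot all_order all_algebra.
From mathcomp Require Import all_classical all_reals all_analysis.

Set Implicit Arguments.
Unset Strict Implicit.
Unset Printing Implicit Defensive.

Import Order.TTheory GRing.Theory Num.Theory.
Import numFieldNormedType.Exports.

Local Open Scope classical_set_scope.
Local Open Scope ring_scope.

(* A measurableType is pointed, hence so are our metric spaces. No generality
   is lost for statements about a sequence of probability measures, since the
   empty space carries none. *)
#[short(type="pmetricType")]
HB.structure Definition PMetric (K : numDomainType) :=
  {T of Metric K T & isPointed T}.

Notation borel X := (g_sigma_algebraType (@open X)).

Section M1.
Context {R : realType} (X : pmetricType R).

Definition bounded_continuous :=
  {f : X -> R | continuous f /\ bounded_fun f}.

Definition integrals (mu : probability (borel X) R) :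
    {ptws bounded_continuous -> R} :=
  fun f => \int[mu]_x sval f x.

(* The topology of weak convergence is the coarsest one that makes
   mu |-> \int f dmu continuous for every bounded continuous f. *)
Definition M1 := initial_topology integrals.

HB.instance Definition _ := Topological.on M1.

Definition weak_cvg (mu : nat -> M1) (nu : M1) :=
  forall f : X -> R, continuous f -> bounded_fun f ->
    \int[mu n]_x f x @[n --> \oo] --> \int[nu]_x f x.

Lemma weak_cvgP (mu : nat -> M1) (nu : M1) :
  weak_cvg mu nu <-> mu @ \oo --> nu.
Proof.
have -> : (mu @ \oo --> nu) <-> {ptws, integrals \o mu @ \oo --> integrals nu}.
  split=> [munu|munu A [_ [[B Bop <-]] Bnu BA]].
    by apply: cvg_comp munu _; exact: initial_continuous.
  have nB : nbhs (integrals nu) B by exact: open_nbhs_nbhs.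
  suff : \forall n \near \oo, A (mu n) by [].
  have : \forall n \near \oo, B (integrals (mu n)) by exact: munu B nB.
  by apply: filterS => n /BA.
rewrite cvg_sup; split=> [munu [f [cf bf]]|munu f cf bf].
  rewrite cvg_image; last by apply/seteqP; split=> // r _; exists (cst r).
  move=> A /(munu f cf bf) nA; exists (@^~ (exist _ f (conj cf bf)) @^-1` A) => //.
  by apply/seteqP; split=> [_ [g gA <-]//|r Ar]; exists (cst r).
have := munu (exist _ f (conj cf bf)).
rewrite cvg_image; last by apply/seteqP; split=> // r _; exists (cst r).
move=> + A nA => /(_ A nA)[B nB <-].
suff : \forall n \near \oo, [set g (exist _ f (conj cf bf)) | g in B]
  (integrals (mu n) (exist _ f (conj cf bf))) by [].
have : \forall n \near \oo, B (integrals (mu n)) by exact: nB.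
by apply: filterS => n Bn; exists (integrals (mu n)).
Qed.

Definition precompact_seq (mu : nat -> M1) :=
  forall phi : nat -> nat, increasing_seq phi ->
    exists psi : nat -> nat, increasing_seq psi /\
      exists nu : M1, weak_cvg (mu \o phi \o psi) nu.

Definition asymptotically_tight (mu : nat -> M1) :=
  forall eps : R, 0 < eps ->
    exists K : set X, compact K /\
      forall G : set X, open G -> K `<=` G ->
        ((1 - eps)%:E <= limn_einf (fun n => mu n G))%E.

Definition complete_set (A : set X) :=
  forall u : nat -> X, (forall n, A (u n)) -> cauchy (u @ \oo) ->
    exists2 x, A x & u @ \oo --> x.

Definition thickening (A : set X) (delta : R) : set X :=
  \bigcup_(x in A) ball x delta.

Definition sequentially_tight (mu : nat -> M1) :=
  forall eps : R, 0 < eps ->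
    exists K : R -> set X,
      [/\ forall delta, 0 < delta -> compact (K delta),
          forall delta, 0 < delta ->
            ((1 - eps)%:E <=
               limn_einf (fun n => mu n (thickening (K delta) delta)))%E
        & complete_set
            (closure (\bigcup_(delta in [set d : R | 0 < d]) K delta))].

Definition tight (A : set M1) :=
  forall eps : R, 0 < eps ->
    exists K : set X, compact K /\
      forall mu : M1, A mu -> ((1 - eps)%:E <= mu K)%E.

Definition subseq_limits (mu : nat -> M1) : set M1 :=
  \bigcap_n closure [set mu k | k in [set k | (n <= k)%N]].

End M1.

(* Main.v *)
Require Import Defs.
From HB Require Import structures.
From mathcomp Require Import all_boot all_order all_algebra.
From mathcomp Require Import all_classical all_reals all_analysis.
From mathcomp Require Import lra.

(* (i) <=> (ii): given sequential tightness, intersect the complete space [T]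
   with the closures of neighbourhoods [B m] of compact sets, of radius [1/(m+1)]
   and asymptotic mass at least [1 - e/2^m]. The result [L] is totally bounded
   and complete, hence compact, and by the same argument every neighbourhood of
   [L] contains a finite intersection of the [B m] with a neighbourhood of [T].

   (i) => (iii): the limit of [mu n A] along an ultrafilter is a finitely additive
   [lam]. The outer measure computed from countable open covers weighted by [lam]
   is a Borel measure [nu] with [nu G <= lam G] on open sets, and asymptotic
   tightness gives it mass one. As [nu] is tight, a countable family of open sets
   approximates all open sets from inside for [nu]; selecting indices along the
   ultrafilter gives a subsequence with [liminf mu n G >= nu G] for all open [G].

   (iii) => (i): were [mu n G] frequently below [1 - e - d], a subsequential limit
   would give [G] mass less than [1 - e]. *)

Set Implicit Arguments.
Unset Strict Implicit.
Unset Printing Implicit Defensive.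

Import Order.TTheory GRing.Theory Num.Theory.
Import numFieldNormedType.Exports.

Local Open Scope classical_set_scope.
Local Open Scope ring_scope.

(** * Metric and measure-theoretic preliminaries *)

Section metric_topology.
Context {R : realType} {X : pmetricType R}.
Implicit Types (A B G K U : set X).

Lemma open_ball_metric (x : X) (r : R) : open (ball x r).
Proof.
rewrite openE => y; rewrite {1}ballEmdist /= => xy.
apply/nbhs_ballP; exists (r - mdist x y) => /=; first by rewrite subr_gt0.
move=> z; rewrite !ballEmdist /= => yz.
by rewrite (le_lt_trans (metric_triangle x y z))// addrC -ltrBrDr.
Qed.

Lemma open_thickening A (r : R) : open (thickening A r).
Proof. by apply: bigcup_open => x _; exact: open_ball_metric. Qed.

Lemma sub_thickening A (r : R) : 0 < r -> A `<=` thickening A r.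
Proof. by move=> r0 x Ax; exists x => //; exact: ballxx. Qed.

(** Closed inner approximations of [U]; when [U] is open, both they and their interiors increase to
    [U]. *)
Definition erosion U n : set X := [set x | ball x n.+1%:R^-1 `<=` U].

Lemma erosion_sub U n : erosion U n `<=` U.
Proof. by move=> x; apply; apply: ballxx; rewrite invr_gt0 ltr0n. Qed.

Lemma erosionE U n : erosion U n = ~` thickening (~` U) n.+1%:R^-1.
Proof.
apply/seteqP; split=> [x xU [y nUy /ball_sym /xU//]|x xU y xy].
by apply: contrapT => nUy; apply: xU; exists y => //; exact: ball_sym.
Qed.

Lemma closed_erosion U n : closed (erosion U n).
Proof. by rewrite erosionE; exact/open_closedC/open_thickening. Qed.

(** The difference of the two consecutive radii leaves room for a ball around each point. *)
Lemma erosion_subS U n : erosion U n `<=` (erosion U n.+1)°.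
Proof.
move=> x xU; apply/nbhs_ballP; exists (n.+1%:R^-1 - n.+2%:R^-1) => /=.
  by rewrite subr_gt0 ltf_pV2 ?posrE ?ltr_nat.
move=> y xy z yz; apply: xU.
by have := ball_triangle xy yz; rewrite subrK.
Qed.

Lemma interior_erosionS U n : (erosion U n)° `<=` (erosion U n.+1)°.
Proof. exact/(subset_trans (@interior_subset _ _))/erosion_subS. Qed.

Lemma open_ball_sub U (x : X) : open U -> U x ->
  exists n, ball x n.+1%:R^-1 `<=` U.
Proof.
move=> oU Ux; have /nbhs_ballP[e /= e0 eU] := open_nbhs_nbhs (conj oU Ux).
have [n _ /(_ n (leqnn n))] := near_infty_natSinv_lt (PosNum e0).
by move=> /= /ltW ne; exists n; apply: subset_trans eU; exact: le_ball.
Qed.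

Lemma bigcup_interior_erosion U : open U -> \bigcup_n (erosion U n)° = U.
Proof.
move=> oU; apply/seteqP; split=> [x [n _ /interior_subset/erosion_sub//]|x Ux].
have [n nU] := open_ball_sub oU Ux.
by exists n.+1 => //; exact: erosion_subS.
Qed.

Lemma bigcup_erosion U : open U -> \bigcup_n erosion U n = U.
Proof.
move=> oU; apply/seteqP; split=> [x [n _ /erosion_sub//]|x Ux].
by have [n nU] := open_ball_sub oU Ux; exists n.
Qed.

Lemma nondecreasing_erosion U : nondecreasing_seq (erosion U).
Proof.
apply/nondecreasing_seqP => n; apply/subsetPset.
by apply: (subset_trans (@erosion_subS U n)); exact: interior_subset.
Qed.

Lemma closed_compact K : compact K -> closed K.
Proof. by apply: compact_closed; exact: metric_hausdorff. Qed.

(** Urysohn's lemma, metric spaces being normal. *)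
Lemma separating_function (A B : set X) : closed A -> closed B ->
  A `&` B = set0 -> exists f : X -> R, [/\ continuous f,
    forall x, 0 <= f x <= 1, forall x, A x -> f x = 0 & forall x, B x -> f x = 1].
Proof.
move=> cA cB AB.
have [f [cf f01 fA fB]] := (@uniform_separatorP _ R _ _).1
  ((@normal_separatorP R X).1 pseudometric_normal A B cA cB AB).
exists f; split=> // [x|x Ax|x Bx].
- by have := f01 (f x); rewrite /= in_itv /=; apply; exists x.
- by apply: fA; exists x.
- by apply: fB; exists x.
Qed.

End metric_topology.

(** * Borel probabilities and integrals of continuous functions *)

Section borel_probability.
Context {R : realType} {X : pmetricType R}.
Implicit Types (P : probability (borel X) R) (f : X -> R).

Lemma measurable_open (G : set X) : open G -> measurable (G : set (borel X)).
Proof. by move=> oG; apply: sub_gen_smallest. Qed.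

Lemma measurable_closed (F : set X) : closed F -> measurable (F : set (borel X)).
Proof.
move=> cF; rewrite -(setCK F); apply: measurableC; apply: measurable_open.
exact: closed_openC.
Qed.

Lemma continuous_measurable f : continuous f ->
  measurable_fun [set: borel X] (f : borel X -> R).
Proof.
move=> cf; apply: (measurability _ (measurable_realfun.RGenOpens.measurableE R)).
move=> _ [_ [a [b ->] <-]]; rewrite setTI; apply: measurable_open.
by apply: open_comp; [move=> x _; exact: cf|exact: interval_open].
Qed.

Lemma bounded_continuous_integrable P f : continuous f -> bounded_fun f ->
  P.-integrable [set: borel X] (EFin \o f).
Proof.
move=> cf bf; apply: measurable_bounded_integrable => //.
- by rewrite -ge0_fin_numE// fin_num_measure.
- exact: continuous_measurable.
Qed.

Lemma Rintegral_indic P (A : set (borel X)) : measurable A ->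
  \int[P]_x (\1_A x) = fine (P A).
Proof. by move=> mA; rewrite /Rintegral integral_indic// setIT. Qed.

Lemma unit_interval_bounded f : (forall x, 0 <= f x <= 1) -> bounded_fun f.
Proof.
move=> f01; exists 1; split=> // M M1 x _; have /andP[f0 f1] := f01 x.
by rewrite /= ger0_norm// (le_trans f1)// ltW.
Qed.

Lemma prob_fineK P (A : set (borel X)) : measurable A -> (fine (P A))%:E = P A.
Proof. by move=> mA; rewrite fineK// fin_num_measure. Qed.

End borel_probability.

(** * Mass of open sets under closure in the weak topology *)

Section closure_in_M1.
Context {R : realType} {X : pmetricType R}.

Lemma integral_continuous_M1 (f : X -> R) : continuous f -> bounded_fun f ->
  continuous (fun mu : M1 X => \int[mu]_x f x).
Proof.
move=> cf bf mu.
pose g : bounded_continuous X := exist _ f (conj cf bf).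
have FF : Filter ((fun m : M1 X => integrals m) @ mu).
  exact/fmap_filter/nbhs_filter.
have : (fun m : M1 X => integrals m) @ mu --> integrals mu.
  exact: initial_continuous.
rewrite cvg_sup => /(_ g).
(* Evaluation at [g] is onto, since constant functionals take every value, so convergence for its
   initial topology is convergence of the values. *)
rewrite cvg_image; last by apply/seteqP; split=> // r _; exists (cst r).
move=> + B nB => /(_ B nB)[C nC <-].
have nC' : nbhs mu [set m : M1 X | C (integrals m)] by exact: nC.
suff : nbhs mu [set m : M1 X | [set h g | h in C] (integrals m g)] by [].
by apply: filterS nC' => m Cm; exists (integrals m).
Qed.

(** Lower semicontinuity of [mu G]. A continuous [f] between the indicators of an erosion of [G] and
    of [G] itself carries the bound from [A] to [nu], and the erosions exhaust [G]. *)
Lemma closure_open_le (A : set (M1 X)) (nu : M1 X) (G : set X) (b : R) :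
  closure A nu -> open G ->
  (forall mu : M1 X, A mu -> (mu G <= b%:E)%E) -> (nu G <= b%:E)%E.
Proof.
move=> Anu oG Ab.
have mE n : measurable (erosion G n : set (borel X)).
  by apply: measurable_closed; exact: closed_erosion.
have nuE n : (nu (erosion G n) <= b%:E)%E.
  have GE0 : ~` G `&` erosion G n = set0.
    by rewrite -subset0 => x [nGx /erosion_sub].
  have [f [cf f01 f0 f1]] := separating_function (open_closedC oG)
    (@closed_erosion _ _ G n) GE0.
  have bf := unit_interval_bounded f01.
  have -> : nu (erosion G n) = (fine (nu (erosion G n)))%:E.
    by rewrite prob_fineK.
  rewrite lee_fin -Rintegral_indic// (@le_trans _ _ (\int[nu]_x f x))//.
    apply: le_Rintegral => //.
    - exact: integrable_indic.
    - exact: bounded_continuous_integrable.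
    - move=> x _; rewrite indicE; case: (asboolP (erosion G n x)) => Ex.
        by rewrite mem_set// f1.
      by rewrite memNset//; have /andP[] := f01 x.
  (* Otherwise the measures with [b < \int f] form a neighbourhood of [nu], which meets [A]; but [f]
     is at most the indicator of [G]. *)
  rewrite leNgt; apply/negP => bnu.
  have : nbhs nu [set m : M1 X | b < \int[m]_x f x].
    have := @integral_continuous_M1 f cf bf nu.
    by move/(_ [set r | b < r]); apply; exact: lt_nbhsr.
  move=> /Anu[m [Am]]; apply/negP; rewrite -leNgt.
  rewrite -lee_fin (le_trans _ (Ab _ Am))// -prob_fineK ?lee_fin; last first.
    exact: measurable_open.
  rewrite -Rintegral_indic; last exact: measurable_open.
  apply: le_Rintegral => //.
  - exact: bounded_continuous_integrable.
  - by apply: integrable_indic; exact: measurable_open.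
  - move=> x _; rewrite indicE; case: (asboolP (G x)) => Gx.
      by rewrite mem_set//; have /andP[] := f01 x.
    by rewrite memNset// f0.
have := @nondecreasing_cvg_mu _ _ _ nu (erosion G) mE.
rewrite bigcup_erosion// => /(_ (measurable_open oG) (@nondecreasing_erosion _ _ G)).
by move=> cE; apply: (cvge_to_le cE); apply: nearW => n; exact: nuE.
Qed.

End closure_in_M1.

(** * Weak convergence from lower bounds on open sets *)

Section layer_sums.
Context {R : realType}.

(* Lower Riemann sum of the layer-cake formula [g = \int_0^oo 1_{t < g} dt]. *)
Definition layers (h g : R) N := \sum_(i < N) h * (h * i.+1%:R < g)%R%:R.

Lemma layers_le h g N : 0 < h -> 0 <= g -> layers h g N <= g.
Proof.
(* The bound [h * N] makes the induction go through: if the next layer counts, then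
   [h * N.+1 < g]. *)
move=> h0 g0; suff : layers h g N <= g /\ layers h g N <= h * N%:R by case.
elim: N => [|N [IHg IHN]]; first by rewrite /layers big_ord0 mulr0.
rewrite /layers big_ord_recr /= -/(layers h g N).
case: ltP => hg; rewrite ?mulr1 ?mulr0 ?addr0; split=> //.
- rewrite (le_trans _ (ltW hg))// -natr1 mulrDr mulr1; exact: lerD.
- by rewrite -natr1 mulrDr mulr1 lerD.
- by rewrite (le_trans IHN)// ler_pM2l// ler_nat.
Qed.

Lemma layers_full h g N : 0 < h -> h * N%:R < g -> layers h g N = h * N%:R.
Proof.
move=> h0; elim: N => [|N IH] hg; first by rewrite /layers big_ord0 mulr0.
rewrite /layers big_ord_recr /= -/(layers h g N) hg mulr1 IH.
  by rewrite -natr1 mulrDr mulr1.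
by rewrite (le_lt_trans _ hg)// ler_pM2l// ler_nat.
Qed.

Lemma le_layers h g N : 0 < h -> g <= h * N.+1%:R -> g <= h + layers h g N.
Proof.
move=> h0; elim: N => [|N IH] hg.
  by rewrite /layers big_ord0 addr0 (le_trans hg)// mulr1.
rewrite /layers big_ord_recr /= -/(layers h g N).
case: ltP => Ng; last by rewrite mulr0 addr0; exact: IH.
rewrite mulr1 layers_full//; last first.
  by rewrite (le_lt_trans _ Ng)// ler_pM2l// ler_nat.
by rewrite (le_trans hg)// -!natr1 !mulrDr mulr1; lra.
Qed.

End layer_sums.

(** * Integrals as sums over open superlevel sets *)

Section portmanteau.
Context {R : realType} {X : pmetricType R}.
Implicit Types (P : probability (borel X) R) (f : X -> R).

Lemma open_superlevel f (a : R) : continuous f -> open [set x | a < f x].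
Proof.
move=> cf; apply: (@open_comp _ _ f [set r | a < r]); last exact: open_gt.
by move=> x _; exact: cf.
Qed.

Lemma Rintegral_prob_cst P (r : R) : \int[P]_x r = r.
Proof.
rewrite Rintegral_cst// -[RHS]mulr1; congr (r * _).
exact: (congr1 fine (probability_setT P)).
Qed.

Lemma Rintegral_layers P f (h : R) N : continuous f ->
  P.-integrable [set: borel X] (EFin \o (fun x => layers h (f x) N)) /\
  \int[P]_x layers h (f x) N =
    \sum_(i < N) h * fine (P [set x | h * i.+1%:R < f x]).
Proof.
move=> cf; elim: N => [|N [IHi IHN]].
  rewrite big_ord0; split.
    by rewrite /comp; under eq_fun do rewrite /layers big_ord0; exact: integrable0.
  by under eq_Rintegral do rewrite /layers big_ord0; rewrite Rintegral_prob_cst.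
set G := [set x | h * N.+1%:R < f x].
have mG : measurable (G : set (borel X)).
  by apply: measurable_open; exact: open_superlevel.
have layersS x : layers h (f x) N.+1 = layers h (f x) N + h * \1_G x.
  rewrite /layers big_ord_recr /= indicE; congr (_ + _ * _%:R).
  by apply/esym; case: (ltP (h * N.+1%:R) (f x)) => hf;
    [rewrite mem_set|rewrite memNset//= /G /= ltNge hf].
have iG : P.-integrable [set: borel X] (EFin \o (fun x => h * \1_G x)).
  rewrite (_ : _ \o _ = (fun x => h%:E * (\1_G x)%:E)%E).
    by apply: integrableZl => //; exact: integrable_indic.
  by apply/funext => x /=; rewrite EFinM.
split.
  by rewrite /comp; under eq_fun do rewrite layersS EFinD; exact: integrableD.
under eq_Rintegral do rewrite layersS.
rewrite RintegralD// IHN big_ord_recr /=; congr (_ + _).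
rewrite RintegralZl ?Rintegral_indic//; exact: integrable_indic.
Qed.

(** Up to [h], the integral of [f] under [nu] is a finite sum of masses of open superlevel sets,
    where the hypothesis applies. Discretization and the hypothesis cost [e / 2] each. *)
Lemma liminf_integral (mu : nat -> M1 X) (nu : M1 X) f (C e : R) :
  (forall (G : set X) (d : R), open G -> 0 < d ->
    \forall n \near \oo, fine (nu G) - d <= fine (mu n G)) ->
  continuous f -> (forall x, 0 <= f x <= C) -> 0 < e ->
  \forall n \near \oo, \int[nu]_x f x - e <= \int[mu n]_x f x.
Proof.
move=> munu cf f0C e0.
have bf : bounded_fun f.
  exists C; split; first exact: num_real.
  move=> M CM x _; have /andP[f0 fC] := f0C x.
  by rewrite /= ger0_norm// (le_trans fC)// ltW.
pose h := e / 2; have h0 : 0 < h by rewrite divr_gt0.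
(* Enough layers of height [h] for the next level to reach the upper bound [C]. *)
pose N := Num.truncn (C / h).
have CN : C <= h * N.+1%:R.
  by rewrite mulrC -ler_pdivrMr// ltW// truncnS_gt.
have nuf : \int[nu]_x f x <=
    h + \sum_(i < N) h * fine (nu [set x | h * i.+1%:R < f x]).
  have [iL <-] := Rintegral_layers nu h N cf.
  have ih : nu.-integrable [set: borel X] (EFin \o cst h).
    exact: finite_measure_integrable_cst.
  rewrite (_ : h + _ = \int[nu]_x (h + layers h (f x) N)); last first.
    by rewrite (RintegralD measurableT ih iL) Rintegral_prob_cst.
  apply: le_Rintegral => //.
  - exact: bounded_continuous_integrable.
  - rewrite /comp; under eq_fun do rewrite EFinD.
    exact: (integrableD measurableT ih iL).
  - move=> x _; apply: le_layers => //; have /andP[_ fC] := f0C x.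
    exact: le_trans CN.
(* With this tolerance the [N] terms, each weighted by [h], lose at most [h] in total. *)
have : \forall n \near \oo, forall i : 'I_N,
    fine (nu [set x | h * i.+1%:R < f x]) - N.+1%:R^-1 <=
    fine (mu n [set x | h * i.+1%:R < f x]).
  apply: filter_forall => i; apply: munu; first exact: open_superlevel.
  by rewrite invr_gt0.
apply: filterS => n mun.
have [iL iLE] := Rintegral_layers (mu n) h N cf.
rewrite (@le_trans _ _ (\int[mu n]_x layers h (f x) N))//; last first.
  apply: le_Rintegral => //; first exact: bounded_continuous_integrable.
  by move=> x _; apply: layers_le => //; have /andP[] := f0C x.
rewrite iLE.
have : \sum_(i < N) h * (fine (nu [set x | h * i.+1%:R < f x]) - N.+1%:R^-1) <=
    \sum_(i < N) h * fine (mu n [set x | h * i.+1%:R < f x]).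
  by apply: ler_sum => i _; rewrite ler_pM2l//; exact: mun.
apply: le_trans; under eq_bigr do rewrite mulrBr.
rewrite sumrB sumr_const card_ord.
have hN : h / N.+1%:R *+ N <= h.
  by rewrite -mulr_natr -mulrA ger_pMr// mulrC ler_pdivrMr// mul1r ler_nat.
by rewrite (splitr e) -/h opprD addrA lerB// lerBlDr addrC.
Qed.

(** Applied to the nonnegative functions [M + f] and [M - f], the one-sided bound gives both halves
    of the limit. *)
Lemma open_liminf_weak_cvg (mu : nat -> M1 X) (nu : M1 X) :
  (forall (G : set X) (d : R), open G -> 0 < d ->
    \forall n \near \oo, fine (nu G) - d <= fine (mu n G)) ->
  weak_cvg mu nu.
Proof.
move=> munu f cf bf; apply/cvgrPdist_le => e e0.
have [M fM] : exists M, forall x, `|f x| <= M.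
  (* [bounded_fun] only gives bounds strictly above [M], whence [M + 1]. *)
  by have [M [_ bM]] := bf; exists (M + 1) => x; apply: bM; rewrite ?ltrDl.
have cstM : forall m : M1 X, m.-integrable [set: borel X] (EFin \o cst M).
  by move=> m; exact: finite_measure_integrable_cst.
have intD : forall m : M1 X,
    \int[m]_x (M + f x) = M + \int[m]_x f x.
  move=> m.
  rewrite (RintegralD measurableT (cstM m) (bounded_continuous_integrable m cf bf)).
  by rewrite Rintegral_prob_cst.
have intB : forall m : M1 X,
    \int[m]_x (M - f x) = M - \int[m]_x f x.
  move=> m.
  rewrite (RintegralB measurableT (cstM m) (bounded_continuous_integrable m cf bf)).
  by rewrite Rintegral_prob_cst.
have cD : continuous (fun x => M + f x).
  by move=> x; apply: cvgD; [exact: cvg_cst|exact: cf].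
have cB : continuous (fun x => M - f x).
  by move=> x; apply: cvgB; [exact: cvg_cst|exact: cf].
have bD x : 0 <= M + f x <= M + M.
  by have := fM x; rewrite ler_norml => /andP[? ?]; lra.
have bB x : 0 <= M - f x <= M + M.
  by have := fM x; rewrite ler_norml => /andP[? ?]; lra.
apply: filterS2 (liminf_integral munu cB bB e0) (liminf_integral munu cD bD e0).
move=> n; rewrite !intD !intB => lB lD.
by rewrite ler_norml; apply/andP; split; [move: lB|move: lD]; lra.
Qed.

End portmanteau.

(** * A Borel probability below a finitely additive content *)

Section measure_of_content.
Context {R : realType} {X : pmetricType R}.
Variable lam : set X -> R.
Hypothesis lam_ge0 : forall A : set (borel X), measurable A -> 0 <= lam A.
Hypothesis lamU : forall A B : set (borel X), measurable A -> measurable B ->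
  A `&` B = set0 -> lam (A `|` B) = lam A + lam B.
Hypothesis lamT : lam setT = 1.

Lemma content0 : lam set0 = 0.
Proof.
have := lamU (@measurable0 _ (borel X)) (@measurable0 _ (borel X)) (setI0 _).
by rewrite setU0 => /eqP; rewrite -subr_eq0 opprD addrA subrr sub0r oppr_eq0 => /eqP.
Qed.

Lemma contentD (A B : set (borel X)) : measurable A -> measurable B ->
  B `<=` A -> lam A = lam B + lam (A `\` B).
Proof.
move=> mA mB BA; rewrite -lamU ?setDUK//; first exact: measurableD.
by rewrite setDIK.
Qed.

Lemma le_content (A B : set (borel X)) : measurable A -> measurable B ->
  B `<=` A -> lam B <= lam A.
Proof.
by move=> mA mB BA; rewrite (contentD mA mB BA) lerDl lam_ge0//; exact: measurableD.
Qed.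

Lemma content_le1 (A : set (borel X)) : measurable A -> lam A <= 1.
Proof. by move=> mA; rewrite -lamT; exact: le_content. Qed.

Lemma contentU2 (A B : set (borel X)) : measurable A -> measurable B ->
  lam (A `|` B) <= lam A + lam B.
Proof.
move=> mA mB; rewrite (contentD (measurableU _ _ mA mB) mA (@subsetUl _ _ _)).
rewrite lerD2l; apply: le_content => //.
  by apply: measurableD => //; exact: measurableU.
by move=> x [[]].
Qed.

Lemma content_bigsetU (F : nat -> set (borel X)) n :
  (forall i, measurable (F i)) ->
  lam (\big[setU/set0]_(i < n) F i) <= \sum_(i < n) lam (F i).
Proof.
move=> mF; elim: n => [|n IH]; first by rewrite !big_ord0 content0.
rewrite !big_ord_recr /= (le_trans (contentU2 _ _))//.
- exact: bigsetU_measurable.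
- by rewrite lerD2r.
Qed.

(* The value [+oo] off the open sets restricts the covers computing the outer
   measure to covers by open sets. *)
Definition open_content (A : set X) : \bar R :=
  if `[< open A >] then (lam A)%:E else +oo%E.

Lemma open_contentE (G : set X) : open G -> open_content G = (lam G)%:E.
Proof. by move=> oG; rewrite /open_content asboolT. Qed.

Lemma open_content0 : open_content set0 = 0%E.
Proof. by rewrite open_contentE ?content0//; exact: open0. Qed.

Lemma open_content_ge0 A : (0 <= open_content A)%E.
Proof.
rewrite /open_content; case: asboolP => [oA|//].
by rewrite lee_fin lam_ge0//; exact: measurable_open.
Qed.

(** [mu_ext] admits covers by measurable sets; with every set measurable, only the weights in
    [open_content] select the open covers. *)
Let discrete := g_sigma_algebraType [set: set X].

Definition content_ext (A : set X) : \bar R :=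
  @mu_ext _ discrete R open_content A.

Let content_ext_mixin := isOuterMeasure.Build R X content_ext
  (@mu_ext0 _ discrete R open_content open_content0 open_content_ge0)
  (@mu_ext_ge0 _ discrete R _ open_content_ge0)
  (@le_mu_ext _ discrete R open_content)
  (@mu_ext_sigma_subadditive _ discrete R _ open_content_ge0).
HB.instance Definition _ := content_ext_mixin.

Lemma content_ext_open (G : set X) : open G -> (content_ext G <= (lam G)%:E)%E.
Proof.
move=> oG; apply: ereal_inf_lbound.
exists (fun n => if n is 0%N then G else set0).
  split=> [i|]; first exact: sub_gen_smallest.
  by move=> x Gx; exists 0%N.
rewrite nneseries_recl//; last by move=> *; exact: open_content_ge0.
rewrite open_contentE// eseries_cond/= eseries0 ?adde0// => -[|n]// _ _.
by rewrite open_content0.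
Qed.

Lemma content_ext_cover (A : set X) (x : \bar R) : (content_ext A < x)%E ->
  exists F : nat -> set X, [/\ forall i, open (F i), A `<=` \bigcup_i F i &
    (\sum_(i <oo) (lam (F i))%:E < x)%E].
Proof.
move=> /ereal_inf_lt[_ [F [_ AF] <-] Fx].
(* A set that is not open would weigh [+oo] and make the whole sum infinite. *)
have oF i : open (F i).
  apply: contrapT => nF; move: Fx; rewrite (@eseries_pinfty _ _ _ i)//.
  - by rewrite ltNge leey.
  - by move=> n _; rewrite -ltNye (lt_le_trans _ (open_content_ge0 _)).
  - by rewrite /open_content asboolF.
exists F; split=> //; move: Fx; congr (_ < x)%E.
by apply: eq_eseriesr => i _; rewrite open_contentE.
Qed.

(** Compactness reduces a countable open cover to a finite one, where finite additivity of [lam]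
    suffices. *)
Lemma compact_content_ext (K : set X) (c : R) : compact K ->
  (forall G, open G -> K `<=` G -> c <= lam G) -> (c%:E <= content_ext K)%E.
Proof.
move=> cK lamK; rewrite leNgt; apply/negP => /content_ext_cover[F [oF KF]].
apply/negP; rewrite -leNgt.
move: cK; rewrite compact_cover => /(_ _ setT F (fun i _ => oF i) KF)[D _ KD].
pose n := (\max_(i <- finmap.enum_fset D) i).+1.
have Kn : K `<=` \big[setU/set0]_(i < n) F i.
  move=> x /KD[i /= iD Fix]; rewrite -bigcup_mkord; exists i => //=.
  by rewrite ltnS; apply: (@leq_bigmax_seq _ _ xpredT id).
have mF i : measurable (F i : set (borel X)) by exact: measurable_open.
have cn : c <= \sum_(i < n) lam (F i).
  rewrite (le_trans _ (content_bigsetU n mF))// lamK//.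
  by rewrite -bigcup_mkord; apply: bigcup_open => i _.
rewrite (@le_trans _ _ (\sum_(0 <= i < n) (lam (F i))%:E)%E)//.
  by rewrite big_mkord sumEFin lee_fin.
by apply: nneseries_lim_ge => i _; rewrite lee_fin lam_ge0.
Qed.

(* The layers [(erosion U i.+2)° \ erosion U i] telescope, so their total
   content beyond [m] is at most twice the content still to be exhausted. *)
Lemma content_ext_erosion (U : set X) (e : R) : open U -> 0 < e ->
  exists m, (content_ext U <= (lam (erosion U m) + e)%:E)%E.
Proof.
move=> oU e0.
pose V i := (erosion U i)°; pose W i := V i.+2 `\` erosion U i.
have oV i : open (V i) by exact: open_interior.
have oW i : open (W i).
  by apply: openI => //; apply: closed_openC; exact: closed_erosion.
have mV i : measurable (V i : set (borel X)) by exact: measurable_open.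
have mE i : measurable (erosion U i : set (borel X)).
  by apply: measurable_closed; exact: closed_erosion.
have ndV : {homo V : i j / (i <= j)%N >-> i `<=` j}.
  apply: homo_leq => [A x//|B A C AB BC|n]; first exact: subset_trans BC.
  exact: interior_erosionS.
pose a i := lam (V i).
have nda : {homo a : i j / (i <= j)%N >-> i <= j}.
  by move=> i j ij; apply: le_content => //; exact: ndV.
have sa : has_sup (range a).
  split; first by exists (a 0%N), 0%N.
  by exists 1 => _ [i _ <-]; exact: content_le1.
(* [m] is chosen so that [a m] is within [e / 2] of the supremum of [a]. *)
have [_ [m _ <-] am] := sup_adherent (divr_gt0 e0 (ltr0n R 2)) sa.
have alt i : a i <= a m + e / 2.
  rewrite -lerBlDr ltW// (le_lt_trans _ am)// lerB//.
  by apply: ub_le_sup; [case: sa|exists i].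
have lamW i : lam (W i) <= a i.+2 - a i.
  rewrite lerBrDr addrC -lamU//; last 2 first.
  - exact: measurable_open.
  - by rewrite -subset0 => x [Vix [_ nE]]; apply: nE; exact: interior_subset.
  apply: le_content => //; first by apply: measurableU => //; exact: measurable_open.
  by move=> x [/(ndV _ i.+2)|[]//]; apply; rewrite (leq_trans (leqnSn _)).
have sumW n : \sum_(m <= i < n) lam (W i) <= e.
  have [nm|mn] := leqP n m; first by rewrite big_geq// ltW.
  have : \sum_(m <= i < n) lam (W i) <= a n.+1 + a n - a m.+1 - a m.
    elim: n mn => // n IH; rewrite ltnS leq_eqVlt => /predU1P[->|mn].
      by rewrite big_nat1 (le_trans (lamW _))//; lra.
    by rewrite big_nat_recr ?(ltnW mn)//=; have := IH mn; have := lamW n; lra.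
  move=> /le_trans; apply.
  have := alt n; have := alt n.+1; have := nda m m.+1 (leqnSn _).
  by rewrite [in X in _ -> _ -> X](splitr e); lra.
have UVW : U `<=` V m.+1 `|` \bigcup_(i in ~` `I_m) W i.
  rewrite -{1}(bigcup_interior_erosion oU) => x [j _ Vjx].
  (* For the least [k] with [x] in [V k], either [k <= m.+1] or [k] is some [k'.+2]; then [x] avoids
     [erosion U k'], which lies in [V k'.+1]. *)
  have [k Vkx kmin] := ex_minnP (ex_intro (fun j => `[< V j x >]) j (asboolT Vjx)).
  move/asboolP in Vkx.
  have [km|mk] := leqP k m.+1; first by left; exact: ndV Vkx.
  right; case: k Vkx kmin mk => [|[|k]]// Vkx kmin mk.
  exists k; first by apply/negP; rewrite -leqNgt -ltnS.
  split=> // Ekx; have /asboolP/kmin := @erosion_subS _ _ U k x Ekx.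
  by rewrite ltnn.
exists m.+1.
rewrite (le_trans (le_outer_measure content_ext _ _ UVW))//.
rewrite (le_trans (outer_measureU2 _ _ _))// EFinD leeD//.
  rewrite (le_trans (content_ext_open _))// lee_fin le_content//.
  exact: interior_subset.
rewrite (le_trans (outer_measure_sigma_subadditive_tail _ _ _))//.
rewrite lime_le//.
  by apply: is_cvg_nneseries => *; exact: outer_measure_ge0.
apply: nearW => n; rewrite (@le_trans _ _ (\sum_(m <= i < n) (lam (W i))%:E)%E)//.
  by apply: lee_sum => i _; exact: content_ext_open.
by rewrite sumEFin lee_fin.
Qed.

(** For an erosion [E] of the intersection, [lam E] reaches the outer measure of the intersection up
    to [e], and [O] minus [E] is an open set containing the other piece; [lam] is additive on these
    two parts of [O]. *)
Lemma content_ext_split (O G : set X) : open O -> open G ->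
  (content_ext (O `&` G) + content_ext (O `&` ~` G) <= (lam O)%:E)%E.
Proof.
move=> oO oG; apply/lee_addgt0Pr => e e0.
have oOG : open (O `&` G) by exact: openI.
have [m OGm] := content_ext_erosion oOG e0.
set E := erosion _ _ in OGm.
have cE : closed E by exact: closed_erosion.
have EOG : E `<=` O `&` G by exact: erosion_sub.
have oOE : open (O `\` E) by apply: openI => //; exact: closed_openC.
have OE : (content_ext (O `&` ~` G) <= (lam (O `\` E))%:E)%E.
  rewrite (le_trans _ (content_ext_open oOE))//; apply: le_outer_measure.
  by move=> x [Ox nGx]; split=> // /EOG[].
rewrite (le_trans (leeD OGm OE))// -EFinD lee_fin addrAC lerD2r.
rewrite -(@contentD O E)//; [exact: measurable_open|exact: measurable_closed|].
by move=> x /EOG[].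
Qed.

(** Split each set of a nearly optimal open cover of [A] along [G]; summing gives the required
    inequality up to [e]. *)
Lemma content_ext_caratheodory (G : set X) : open G ->
  content_ext.-caratheodory G.
Proof.
move=> oG; apply: le_caratheodory_measurable => A.
(* Finiteness of the outer measure is what makes adding [e] strict. *)
have A_fin : content_ext A \is a fin_num.
  rewrite ge0_fin_numE; last exact: outer_measure_ge0.
  rewrite (@le_lt_trans _ _ (lam setT)%:E) ?ltry//.
  by rewrite (le_trans _ (content_ext_open openT))//; exact: le_outer_measure.
apply/lee_addgt0Pr => e e0.
have : (content_ext A < content_ext A + e%:E)%E by rewrite lteDl// lte_fin.
move=> /content_ext_cover[F [oF AF /ltW]]; apply: le_trans.
have sub (B : set X) : (content_ext (A `&` B) <=
    \sum_(i <oo) content_ext (F i `&` B))%E.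
  rewrite (le_trans _ (outer_measure_sigma_subadditive content_ext _))//.
  by apply: le_outer_measure; rewrite -setI_bigcupl; exact: setSI.
rewrite (le_trans (leeD (sub G) (sub (~` G))))//.
rewrite -nneseriesD; try by move=> *; exact: outer_measure_ge0.
apply: lee_nneseries => [i _ _|i _]; last exact: content_ext_split.
by apply: adde_ge0; exact: outer_measure_ge0.
Qed.

(** The Caratheodory sets form a sigma-algebra containing the open sets. *)
Lemma measurable_content_ext (A : set (borel X)) : measurable A ->
  content_ext.-caratheodory (A : set X).
Proof.
suff : <<s @open X >> `<=` content_ext.-cara.-measurable by apply.
apply: smallest_sub; first exact: sigma_algebra_measurable.
exact: content_ext_caratheodory.
Qed.

Definition content_measure : set (borel X) -> \bar R := content_ext.

Let content_measure_sigma_additive : semi_sigma_additive content_measure.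
Proof.
move=> F mF tF mUF; apply: (@caratheodory_measure_sigma_additive _ _ content_ext) => //.
- by move=> i; exact: measurable_content_ext.
- exact: measurable_content_ext.
Qed.

HB.instance Definition _ := isMeasure.Build _ (borel X) R content_measure
  (outer_measure0 content_ext) (outer_measure_ge0 content_ext)
  content_measure_sigma_additive.

Hypothesis lam_tight : forall e : R, 0 < e -> exists K : set X, compact K /\
  forall G, open G -> K `<=` G -> 1 - e <= lam G.

Let content_measure_setT : content_measure setT = 1%E.
Proof.
apply/eqP; rewrite eq_le; apply/andP; split.
  by rewrite -lamT; apply: content_ext_open; exact: openT.
apply/lee_addgt0Pr => e e0; have [K [cK lamK]] := lam_tight e0.
rewrite -leeBlDr// -EFinB (le_trans (compact_content_ext cK lamK))//.
exact: le_outer_measure.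
Qed.

HB.instance Definition _ := Measure_isProbability.Build _ (borel X) R
  content_measure content_measure_setT.

(** The second bound turns the asymptotic tightness of [lam] into tightness of [P], with the same
    compact sets. *)
Lemma exists_probability_le_content : exists P : probability (borel X) R,
  (forall G : set X, open G -> (P G <= (lam G)%:E)%E) /\
  forall (K : set X) (c : R), compact K ->
    (forall G, open G -> K `<=` G -> c <= lam G) -> (c%:E <= P K)%E.
Proof.
exists content_measure; split; [exact: content_ext_open|exact: compact_content_ext].
Qed.

End measure_of_content.

(** * Tightness and subsequential limits *)

Section eventual_bounds.
Context {R : realType}.

Lemma limn_einf_near (u : (\bar R)^nat) (a b : R) :
  (a%:E <= limn_einf u)%E -> b < a -> \forall n \near \oo, (b%:E < u n)%E.
Proof.
move=> au ba; have : (b%:E < limn_einf u)%E by rewrite (lt_le_trans _ au)// lte_fin.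
rewrite limn_einf_lim (cvg_lim _ (@cvg_einfs_sup _ u))//.
move=> /ereal_sup_gt[_ [N _ <-] bN]; exists N => // n /= Nn.
by rewrite (lt_le_trans bN)//; apply: ereal_inf_lbound; exists n.
Qed.

Lemma le_limn_einf (u : (\bar R)^nat) (a : R) :
  (forall e, 0 < e -> \forall n \near \oo, ((a - e)%:E <= u n)%E) ->
  (a%:E <= limn_einf u)%E.
Proof.
move=> au; apply/lee_addgt0Pr => e e0; rewrite -leeBlDr// -EFinB.
have [N _ uN] := au e e0.
rewrite limn_einf_lim (cvg_lim _ (@cvg_einfs_sup _ u))//.
apply: le_trans (ereal_sup_ubound _); last by exists N.
by apply: le_ereal_inf_tmp => _ [n /= Nn <-]; exact: uN.
Qed.

Lemma increasing_seq_near (phi : nat -> nat) (P : nat -> Prop) :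
  increasing_seq phi -> (\forall n \near \oo, P n) ->
  \forall n \near \oo, P (phi n).
Proof.
move=> iphi [N _ PN]; exists N => // n /= Nn; apply: PN => /=.
(* An increasing sequence of indices satisfies [n <= phi n]. *)
rewrite (leq_trans Nn)//; elim: n {Nn} => // n IH.
by rewrite (leq_ltn_trans IH)// ltnNge -leEnat iphi -ltnNge.
Qed.

Lemma ultra_fmap (T S : Type) (f : T -> S) (F : set_system T) :
  UltraFilter F -> UltraFilter (fmap f F).
Proof.
move=> UF; split; first exact: fmap_proper_filter.
move=> G PG FG; apply/seteqP; split=> [A GA|A]; last exact: FG.
have [//|nA] := in_ultra_setVsetC (f @^-1` A) UF.
have GnA : G (~` A) by apply: FG.
have GAnA : G (A `&` ~` A) by exact: filterI.
by have [x []] := filter_ex GAnA.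
Qed.

Lemma ultra_bounded_cvg (F : set_system nat) (u : nat -> R) (a b : R) :
  UltraFilter F -> (forall n, a <= u n <= b) -> cvg (u @ F).
Proof.
move=> UF uab; have := @segment_compact R a b; rewrite compact_ultra.
have uI : F (u @^-1` [set` `[a, b]]).
  by apply: filterE => n; rewrite /= in_itv /= uab.
by move=> /(_ _ (ultra_fmap u UF) uI)[l [_ ul]]; apply/cvg_ex; exists l.
Qed.

End eventual_bounds.

(** * Eventual tightness and inner approximation *)

Section eventual_tightness.
Context {R : realType} {X : pmetricType R}.
Implicit Types (P : probability (borel X) R) (mu : nat -> M1 X).

Lemma prob_fine01 P (A : set (borel X)) : measurable A -> 0 <= fine (P A) <= 1.
Proof.
move=> mA; rewrite fine_ge0 //= -lee_fin prob_fineK//.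
exact: probability_le1.
Qed.

Lemma le_prob_fine P (A B : set (borel X)) : measurable A -> measurable B ->
  A `<=` B -> fine (P A) <= fine (P B).
Proof.
move=> mA mB AB; rewrite -lee_fin !prob_fineK//.
by apply: le_measure; rewrite ?inE.
Qed.

Lemma prob_fineU P (A B : set (borel X)) : measurable A -> measurable B ->
  A `&` B = set0 -> fine (P (A `|` B)) = fine (P A) + fine (P B).
Proof.
move=> mA mB AB; apply: EFin_inj; rewrite EFinD !prob_fineK//.
  exact: measureU.
exact: measurableU.
Qed.

Lemma prob_fineC P (A : set (borel X)) : measurable A ->
  fine (P (~` A)) = 1 - fine (P A).
Proof.
move=> mA; apply: EFin_inj; rewrite EFinB !prob_fineK//.
  exact: probability_setC.
exact: measurableC.
Qed.

Lemma prob_fineU_le P (A B C : set (borel X)) :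
  measurable A -> measurable B -> measurable C -> A `<=` B `|` C ->
  fine (P A) <= fine (P B) + fine (P C).
Proof.
move=> mA mB mC ABC.
have mCB : measurable (C `\` B) by exact: measurableD.
rewrite (@le_trans _ _ (fine (P (B `|` (C `\` B)))))//.
  apply: le_prob_fine => //; first exact: measurableU.
  by move=> x /ABC[Bx|Cx]; [left|have [|] := pselect (B x); [left|right]].
by rewrite prob_fineU ?setDIK// lerD2l le_prob_fine//; exact: subDsetl.
Qed.

Definition eventually_tight mu := forall e : R, 0 < e ->
  exists K : set X, compact K /\ forall G, open G -> K `<=` G ->
    \forall n \near \oo, 1 - e <= fine (mu n G).

(** A lower limit only bounds the terms up to an arbitrarily small loss; halving [e] absorbs it. *)
Lemma asymptotically_tightP mu : asymptotically_tight mu <-> eventually_tight mu.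
Proof.
split=> mut e e0; last first.
  have [K [cK KG]] := mut e e0; exists K; split=> // G oG KsG.
  apply: le_limn_einf => d d0; apply: filterS (KG G oG KsG) => n en.
  rewrite -prob_fineK; last exact: measurable_open.
  by rewrite lee_fin (le_trans _ en)// gerBl ltW.
have [K [cK KG]] := mut (e / 2) (divr_gt0 e0 (ltr0n R 2)).
exists K; split=> // G oG KsG.
have ee : 1 - e < 1 - e / 2 by rewrite ltrD2l ltrN2 gtr_pMr// invf_lt1// ltr1n.
apply: filterS (limn_einf_near (KG G oG KsG) ee) => n en.
by rewrite -lee_fin prob_fineK ?ltW//; exact: measurable_open.
Qed.

Lemma eventually_tight_sub mu (phi : nat -> nat) : increasing_seq phi ->
  eventually_tight mu -> eventually_tight (mu \o phi).
Proof.
move=> iphi mut e e0; have [K [cK KG]] := mut e e0.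
exists K; split=> // G oG KsG.
exact: (increasing_seq_near iphi (KG G oG KsG)).
Qed.

Lemma prob_erosion P (G : set X) (e : R) : open G -> 0 < e ->
  exists m, fine (P G) - e <= fine (P (erosion G m)).
Proof.
move=> oG e0.
have mE n : measurable (erosion G n : set (borel X)).
  by apply: measurable_closed; exact: closed_erosion.
have := @nondecreasing_cvg_mu _ _ _ P (erosion G) mE.
rewrite bigcup_erosion// => /(_ (measurable_open oG) (@nondecreasing_erosion _ _ G)).
move=> PE; have : P \o erosion G @ \oo --> (fine (P G))%:E.
  by rewrite prob_fineK//; exact: measurable_open.
move=> /fine_cvg/cvgrPdist_le/(_ e e0)[m _ /(_ m (leqnn m))] /=.
by rewrite ler_norml => /andP[_]; rewrite lerBlDr addrC -lerBlDr => mP; exists m.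
Qed.

(* The [k]-th set decodes [k] into an index [i] and a list of positions in a
   finite net of a compact set of mass at least [1 - 1/(i+1)]. *)
Lemma countable_inner_regular P :
  (forall e : R, 0 < e -> exists K, compact K /\ 1 - e <= fine (P K)) ->
  exists H : nat -> set X, (forall k, open (H k)) /\
    forall (G : set X) (e : R), open G -> 0 < e ->
      exists k, H k `<=` G /\ fine (P G) - e <= fine (P (H k)).
Proof.
move=> tP; pose r i : R := i.+1%:R^-1.
have r0 i : 0 < r i by rewrite invr_gt0 ltr0n.
have /choice[K] : forall i, exists K, compact K /\ 1 - r i <= fine (P K).
  by move=> i; exact: tP.
move=> /all_and2[cK PK].
have /choice[E KE] : forall i, exists E : seq X,
    K i `<=` \bigcup_(x in [set` E]) ball x (r i).
  move=> i; have := cK i; rewrite compact_cover.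
  move=> /(_ _ (K i) (fun x => ball x (r i)) (fun x _ => @open_ball_metric _ _ x _)).
  move=> []; first by move=> x Kx; exists x => //; exact: ballxx.
  by move=> D _ KD; exists (finmap.enum_fset D).
pose U i (s : seq nat) : set X :=
  \bigcup_(a in [set` s]) ball (nth point (E i) a) (r i).
pose H k : set X := if unpickle k is Some (i, s) then U i s else set0.
have oU i s : open (U i s) by apply: bigcup_open => a _; exact: open_ball_metric.
exists H; split=> [k|G e oG e0].
  by rewrite /H; case: unpickle => [[i s]|]; [exact: oU|exact: open0].
have e20 : 0 < e / 2 by rewrite divr_gt0.
have [m PG] := prob_erosion P oG e20.
have [j _ /(_ j (leqnn j))/ltW /= je] := near_infty_natSinv_lt (PosNum e20).
(* [i >= j] makes the mass lost outside [K i] at most [e / 2]; [i >= m.*2.+1] makes twice the radius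
   [r i] at most [1/(m+1)]. *)
pose i := maxn j (m.*2.+1).
have ie : r i <= e / 2.
  by rewrite (le_trans _ je)// lef_pV2 ?posrE// ler_nat ltnS leq_maxl.
have im : r i + r i <= m.+1%:R^-1.
  have rim : r i <= m.+1%:R^-1 / 2.
    rewrite -invfM -natrM lef_pV2 ?posrE ?ltr0n// ler_nat muln2 doubleS ltnS.
    exact: leq_maxr.
  by rewrite [leRHS]splitr lerD.
(* Keep the net points whose balls meet the erosion: those balls stay inside [G] and cover the part
   of the erosion in [K i]. *)
pose s := [seq a <- iota 0 (size (E i)) |
  `[< exists y, erosion G m y /\ ball (nth point (E i) a) (r i) y >]].
exists (pickle (i, s)); rewrite /H pickleK; split.
  move=> z [a /=]; rewrite mem_filter => /andP[/asboolP[y [Ey xy]] _] xz; apply: Ey.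
  by apply: le_ball im _ _; exact: ball_triangle (ball_sym xy) xz.
have EUK : erosion G m `<=` U i s `|` ~` K i.
  move=> y Ey; have [/KE[x /= xE xy]|] := pselect (K i y); last by right.
  left; exists (index x (E i)); last by rewrite nth_index.
  rewrite /= mem_filter mem_iota add0n index_mem xE !andbT /=.
  by apply/asboolP; exists y; rewrite nth_index.
have mK : measurable (K i : set (borel X)).
  by apply: measurable_closed; exact: closed_compact.
have := prob_fineU_le P (measurable_closed (@closed_erosion _ _ G m))
  (measurable_open (oU i s)) (measurableC mK) EUK.
rewrite prob_fineC// => PEU.
have sum4 (g a u k d : R) : g - e / 2 <= a -> a <= u + (1 - k) -> 1 - d <= k ->
  d <= e / 2 -> g - e <= u by lra.
exact: sum4 PG PEU (PK i) ie.
Qed.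

End eventual_tightness.

(** * Extraction of a weakly convergent subsequence *)

Section prokhorov.
Context {R : realType} {X : pmetricType R}.
Implicit Types (mu : nat -> M1 X).

(** Indices are chosen recursively, each above the previous one, which is possible because every
    [P k] holds arbitrarily far out. *)
Lemma diagonal_increasing_seq (P : nat -> nat -> Prop) :
  (forall k N, exists n, (N <= n)%N /\ P k n) ->
  exists2 psi : nat -> nat, increasing_seq psi & forall k, P k (psi k).
Proof.
move=> PkN; have /choice[g gP] : forall kN : nat * nat, exists n,
  (kN.2 <= n)%N /\ P kN.1 n by move=> [k N]; exact: PkN.
pose psi := fix psi k := if k is k'.+1 then g (k, (psi k').+1) else g (0, 0)%N.
exists psi.
  by apply/increasing_seqP => k; rewrite ltEnat; exact: (gP (k.+1, (psi k).+1)).1.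
by case=> [|k]; [exact: (gP (0, 0)%N).2|exact: (gP (k.+1, _)).2].
Qed.

Section ultrafilter_content.
Context (mu : nat -> M1 X) (F : set_system nat) {UF : UltraFilter F}.

Definition ultra_content (A : set X) : R := lim (fine (mu n A) @[n --> F]).

Lemma ultra_contentP (A : set (borel X)) : measurable A ->
  fine (mu n A) @[n --> F] --> ultra_content A.
Proof. by move=> mA; apply: (ultra_bounded_cvg UF) => n; exact: prob_fine01. Qed.

Lemma ultra_content_ge0 (A : set (borel X)) : measurable A ->
  0 <= ultra_content A.
Proof.
move=> mA; apply: (cvgr_to_ge (ultra_contentP mA)).
by apply: filterE => n; have /andP[] := prob_fine01 (mu n) mA.
Qed.

Lemma ultra_contentU (A B : set (borel X)) : measurable A -> measurable B ->
  A `&` B = set0 -> ultra_content (A `|` B) = ultra_content A + ultra_content B.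
Proof.
move=> mA mB AB.
apply: (@cvg_unique _ (@Rhausdorff R) _ _ _ _ (ultra_contentP (measurableU _ _ mA mB))).
rewrite (_ : (fun n => _) = (fun n => fine (mu n A) + fine (mu n B))); last first.
  by apply/funext => n; exact: prob_fineU.
by apply: cvgD; exact: ultra_contentP.
Qed.

Lemma ultra_contentT : ultra_content setT = 1.
Proof.
rewrite /ultra_content (_ : (fun n => _) = cst 1); last first.
  by apply/funext => n; exact: (congr1 fine (probability_setT (mu n))).
exact: lim_cst.
Qed.

End ultrafilter_content.

Lemma eventually_tight_subsequence mu : eventually_tight mu ->
  exists psi : nat -> nat, increasing_seq psi /\
    exists nu : M1 X, weak_cvg (mu \o psi) nu.
Proof.
move=> mut.
(* Being finer than [\oo], [F] contains every event that holds eventually. *)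
have [F [UF oF]] := @ultraFilterLemma nat \oo _.
pose lam := ultra_content mu F.
have lamP (A : set (borel X)) : measurable A -> fine (mu n A) @[n --> F] --> lam A.
  exact: ultra_contentP.
have lam_tight (e : R) : 0 < e -> exists K : set X, compact K /\
    forall G, open G -> K `<=` G -> 1 - e <= lam G.
  move=> e0; have [K [cK KG]] := mut e e0; exists K; split=> // G oG KsG.
  apply: (cvgr_to_ge (lamP _ (measurable_open oG))).
  by apply: oF; exact: KG.
have [nu [nu_lam nu_compact]] := exists_probability_le_content
  (@ultra_content_ge0 mu F UF) (@ultra_contentU mu F UF) (@ultra_contentT mu F UF)
  lam_tight.
have nu_tight (e : R) : 0 < e -> exists K : set X, compact K /\ 1 - e <= fine (nu K).
  move=> e0; have [K [cK KG]] := lam_tight e e0; exists K; split=> //.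
  rewrite -lee_fin prob_fineK; first exact: nu_compact.
  by apply: measurable_closed; exact: closed_compact.
have [H [oH HG]] := countable_inner_regular nu_tight.
(* Since [nu (H i)] is at most [lam (H i)], the limit of [mu n (H i)] along [F], the lower bound
   holds on a set of [F]. *)
have FH i (e : R) : 0 < e -> F [set n | fine (nu (H i)) - e <= fine (mu n (H i))].
  move=> e0; have nuH : fine (nu (H i)) - e < lam (H i).
    rewrite ltrBlDr (le_lt_trans (_ : _ <= lam (H i)))// ?ltrDl//.
    by rewrite -lee_fin prob_fineK ?nu_lam//; exact: measurable_open.
  have FltH : F [set n | fine (nu (H i)) - e < fine (mu n (H i))].
    by have /cvgr_gt := lamP _ (measurable_open (oH i)); apply.
  by apply: filterS FltH => n /ltW.
(* Stage [k] treats only [H 0], ..., [H k] with tolerance [1/(k+1)]: finitely many events of [F],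
   whose intersection meets every tail. *)
have [psi ipsi psiH] : exists2 psi : nat -> nat, increasing_seq psi &
    forall k (i : 'I_k.+1), fine (nu (H i)) - k.+1%:R^-1 <= fine (mu (psi k) (H i)).
  apply: (@diagonal_increasing_seq (fun k n => forall i : 'I_k.+1,
    fine (nu (H i)) - k.+1%:R^-1 <= fine (mu n (H i)))) => k N.
  have FN : F [set n | (N <= n)%N] by apply: oF; exists N.
  have FB : F [set n | forall i : 'I_k.+1,
      fine (nu (H i)) - k.+1%:R^-1 <= fine (mu n (H i))].
    by apply: filter_forall => i; apply: FH; rewrite invr_gt0.
  by have [n [Nn Bn]] := filter_ex (filterI FN FB); exists n.
exists psi; split=> //.
exists nu; apply: open_liminf_weak_cvg => G d oG d0.
(* Half of [d] pays for approximating [G] by [H j], half for the tolerance at stage [k >= j]. *)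
have d20 : 0 < d / 2 by rewrite divr_gt0.
have [j [HjG nuHj]] := HG G (d / 2) oG d20.
near=> k.
have jk : (j < k.+1)%N by near: k; exists j.
have kd : k.+1%:R^-1 <= d / 2.
  by apply: ltW; near: k; exact: (near_infty_natSinv_lt (PosNum d20)).
have := psiH k (Ordinal jk); rewrite /= => muHj.
have muG : fine (mu (psi k) (H j)) <= fine (mu (psi k) G).
  by apply: le_prob_fine => //; exact: measurable_open.
have sum4 (a b c t u : R) : a - d / 2 <= b -> b - t <= c -> c <= u -> t <= d / 2 ->
  a - d <= u by lra.
exact: sum4 nuHj muHj muG kd.
Unshelve. all: by end_near. Qed.

End prokhorov.

(** * Tightness of the set of subsequential limits *)

Section tightness_and_limits.
Context {R : realType} {X : pmetricType R}.
Implicit Types (mu : nat -> M1 X).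

Lemma weak_cvg_closure mu nu (A : set (M1 X)) :
  weak_cvg mu nu -> (\forall n \near \oo, A (mu n)) -> closure A nu.
Proof.
move=> /weak_cvgP munu An B nB.
have Bn : \forall n \near \oo, B (mu n) by exact: munu B nB.
by have [n [/= ? ?]] := filter_ex (filterI An Bn); exists (mu n).
Qed.

Lemma weak_cvg_subseq_limits mu (phi : nat -> nat) nu :
  increasing_seq phi -> weak_cvg (mu \o phi) nu -> subseq_limits mu nu.
Proof.
move=> iphi munu n _; apply: (weak_cvg_closure munu).
have nn : \forall k \near \oo, (n <= k)%N by exists n.
by apply: filterS (increasing_seq_near iphi nn) => k nk; exists (phi k).
Qed.

(** The same compact [K] works. The complement of [K] may keep mass, but each erosion of it misses
    an open neighbourhood of [K], so it eventually has mass at most [e]; the interiors pass this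
    bound to the limits and exhaust the complement. *)
Lemma eventually_tight_limits mu :
  eventually_tight mu -> tight (subseq_limits mu).
Proof.
move=> mut e e0; have [K [cK KG]] := mut e e0; exists K; split=> // nu Lnu.
have clK := closed_compact cK.
have mK : measurable (K : set (borel X)) by exact: measurable_closed.
have oKC : open (~` K) by exact: closed_openC.
have nuV j : fine (nu ((erosion (~` K) j)°)) <= e.
  have oV : open ((erosion (~` K) j)°) by exact: open_interior.
  have mV := measurable_open oV.
  have oE : open (~` erosion (~` K) j).
    by apply: closed_openC; exact: closed_erosion.
  have KE : K `<=` ~` erosion (~` K) j by move=> x Kx /erosion_sub.
  have [N _ muN] := KG _ oE KE.
  rewrite -lee_fin prob_fineK//; apply: (closure_open_le (Lnu N I) oV).
  move=> _ [k /= Nk <-]; rewrite -prob_fineK// lee_fin.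
  have := muN k Nk; rewrite /= prob_fineC; last first.
    by apply: measurable_closed; exact: closed_erosion.
  rewrite lerD2l lerN2; apply: le_trans; apply: le_prob_fine => //.
    by apply: measurable_closed; exact: closed_erosion.
  exact: interior_subset.
rewrite -prob_fineK// lee_fin; apply/ler_addgt0Pr => d d0.
have [m] := prob_erosion nu oKC d0.
rewrite prob_fineC// => nuK.
have : fine (nu (erosion (~` K) m)) <= e.
  rewrite (le_trans _ (nuV m.+1))//; apply: le_prob_fine.
  - by apply: measurable_closed; exact: closed_erosion.
  - by apply: measurable_open; exact: open_interior.
  - exact: erosion_subS.
by move=> nuE; have := le_trans nuK nuE; lra.
Qed.

Lemma precompact_tight_limits mu :
  precompact_seq mu -> tight (subseq_limits mu) -> asymptotically_tight mu.
Proof.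
move=> pmu Lt e e0; have [K [cK LK]] := Lt e e0; exists K; split=> // G oG KG.
have mK : measurable (K : set (borel X)).
  by apply: measurable_closed; exact: closed_compact.
have mG := measurable_open oG.
apply: le_limn_einf => d d0; apply: contrapT => nmuG.
(* Infinitely many indices violate the bound; [phi] enumerates some of them. *)
have [phi iphi muphi] : exists2 phi : nat -> nat, increasing_seq phi &
    forall k, (mu (phi k) G <= (1 - e - d)%:E)%E.
  apply: (@diagonal_increasing_seq (fun _ n => (mu n G <= (1 - e - d)%:E)%E)).
  move=> _ N; apply: contrapT => nN; apply: nmuG; exists N => // n /= Nn.
  by rewrite leNgt; apply/negP => muG; apply: nN; exists n; split=> //; exact: ltW.
have [psi [ipsi [nu munu]]] := pmu phi iphi.
have Lnu : subseq_limits mu nu.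
  apply: (@weak_cvg_subseq_limits _ (phi \o psi)) => //.
  by move=> m n; exact: (etrans (iphi _ _) (ipsi _ _)).
(* The mass of [G] is lower semicontinuous, so the bound passes to [nu], against [nu K >= 1 - e]. *)
have nuG : (nu G <= (1 - e - d)%:E)%E.
  apply: (@closure_open_le _ _ [set m : M1 X | (m G <= (1 - e - d)%:E)%E]) => //.
  by apply: (weak_cvg_closure munu); apply: nearW => n; exact: muphi.
have nuKG : (nu K <= nu G)%E by apply: le_measure; rewrite ?inE.
have := le_trans (LK nu Lnu) (le_trans nuKG nuG).
by rewrite lee_fin; apply/negP; rewrite -ltNge; lra.
Qed.

End tightness_and_limits.

(** * Sequential versus asymptotic tightness *)

Section sequential_tightness.
Context {R : realType} {X : pmetricType R}.
Implicit Types (mu : nat -> M1 X).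

Lemma compact_complete (K : set X) : compact K -> complete_set K.
Proof.
move=> cK u Ku cu; have FK : \forall n \near \oo, K (u n) by exact: nearW.
have ux : u @ \oo --> lim (u @ \oo).
  exact: (@compact_cauchy_cvg X K (u @ \oo) _ cu FK cK).
by exists (lim (u @ \oo)) => //; exact: (closed_cvg _ (closed_compact cK) FK _ ux).
Qed.

(** The constant family [K] works: every thickening is an open neighbourhood of [K], and [K] is
    closed and complete. *)
Lemma asymptotically_sequentially_tight mu :
  asymptotically_tight mu -> sequentially_tight mu.
Proof.
move=> mut e e0; have [K [cK KG]] := mut e e0.
exists (cst K); split=> [//|d d0|].
  by apply: KG; [exact: open_thickening|exact: sub_thickening].
rewrite (_ : \bigcup_(d in _) _ = K); last first.
  by apply/seteqP; split=> [x [d _]//|x Kx]; exists 1 => //=.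
by rewrite -(closure_id _).1; [exact: compact_complete|exact: closed_compact].
Qed.

(* Only sequences are assumed to converge in [T], so a Cauchy sequence is
   extracted from the ultrafilter. *)
Lemma ultra_complete_cvg (T : set X) (F : set_system X) : UltraFilter F ->
  complete_set T ->
  (forall r : R, 0 < r -> exists C, compact C /\ F (thickening C r)) ->
  (forall r : R, 0 < r -> F (thickening T r)) ->
  exists p, T p /\ F --> p.
Proof.
move=> UF cT FC FT.
have FT2 (r : R) : 0 < r -> exists y, T y /\ F (ball y r).
  (* The path from [y] through [x] and [c] to [z] below is shorter than five times [r / 6]. *)
  move=> r0; have r40 : 0 < r / 6 by rewrite divr_gt0.
  have [C [cC FCr]] := FC _ r40.
  (* [k] sends points of the thickening to nearby points of [C], with default value [point]
     elsewhere; the image of [F] is an ultrafilter containing the compact set [C], with a limit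
     [c]. *)
  have /choice[k kP] : forall x, exists c, thickening C (r / 6) x ->
      C c /\ ball c (r / 6) x.
    move=> x; have [[c Cc cx]|nx] := pselect (thickening C (r / 6) x).
      by exists c.
    by exists point.
  have kC : F (k @^-1` C) by apply: filterS FCr => x /kP[].
  move: cC; rewrite compact_ultra => /(_ _ (ultra_fmap k UF) kC)[c [_ kc]].
  have Fc : F (k @^-1` ball c (r / 6)) by exact: (kc _ (nbhsx_ballx _ _ r40)).
  have Fcx : F (ball c (r / 6 + r / 6)).
    apply: filterS (filterI FCr Fc) => x [/kP[_ kx] ck].
    exact: ball_triangle ck kx.
  (* Two sets of [F] meet, which yields a centre in [T] in place of [c]. *)
  have [x [[y Ty yx] cx]] := filter_ex (filterI (FT _ r40) Fcx).
  exists y; split=> //; apply: filterS Fcx => z cz.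
  have := ball_triangle (ball_triangle yx (ball_sym cx)) cz.
  by apply: le_ball; lra.
pose r n : R := n.+1%:R^-1.
have r0 n : 0 < r n by rewrite invr_gt0.
have /choice[y yP] : forall n, exists y, T y /\ F (ball y (r n)).
  by move=> n; exact: FT2.
(* Balls belonging to [F] intersect pairwise, so their centres form a Cauchy sequence. *)
have yy m n : ball (y m) (r m + r n) (y n).
  have [z [mz nz]] := filter_ex (filterI (yP m).2 (yP n).2).
  exact: ball_triangle mz (ball_sym nz).
have r_small (e : R) : 0 < e -> \forall n \near \oo, r n < e.
  by move=> e0; exact: (near_infty_natSinv_lt (PosNum e0)).
have [p Tp yp] : exists2 p, T p & y @ \oo --> p.
  apply: cT; first by move=> n; exact: (yP n).1.
  apply: cauchy_exP => e e0; have e20 : 0 < e / 2 by rewrite divr_gt0.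
  have [N _ rN] := r_small _ e20.
  exists (y N); exists N => // n /= Nn.
  apply: le_ball (yy N n); rewrite [leRHS]splitr.
  exact: lerD (ltW (rN _ (leqnn N))) (ltW (rN _ Nn)).
exists p; split=> // A /nbhs_ballP[e /= e0 pA].
have e20 : 0 < e / 2 by rewrite divr_gt0.
have yp2 : \forall n \near \oo, ball p (e / 2) (y n).
  by apply: yp; exact: nbhsx_ballx.
have [n [/= pn rn]] := filter_ex (filterI yp2 (r_small _ e20)).
apply: filterS (yP n).2 => z yz; apply: pA.
by have := ball_triangle pn yz; apply: le_ball; rewrite [leRHS]splitr lerD2l ltW.
Qed.

Lemma closure_thickening (C : set X) (r : R) : 0 < r ->
  closure (thickening C r) `<=` thickening C (r + r).
Proof.
move=> r0 x /(_ _ (nbhsx_ballx x r r0))[z [[c Cc cz] xz]].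
by exists c => //; exact: ball_triangle cz (ball_sym xz).
Qed.

Lemma le_thickening (C : set X) (r s : R) : r <= s ->
  thickening C r `<=` thickening C s.
Proof. by move=> rs x [c Cc cx]; exists c => //; exact: le_ball cx. Qed.

(** The errors form a geometric sum, [e/2 + ... + e/2^M = e - e/2^M]. *)
Lemma eventually_bigsetI mu (B : nat -> set X) (e : R) M :
  (forall m, open (B m)) ->
  (forall m, \forall n \near \oo, 1 - e / 2 ^+ m.+1 <= fine (mu n (B m))) ->
  \forall n \near \oo,
    1 - (e - e / 2 ^+ M) <= fine (mu n (\big[setI/setT]_(m < M) B m)).
Proof.
move=> oB muB; elim: M => [|M IH].
  apply: nearW => n; rewrite big_ord0 expr0 divr1 subrr subr0.
  by rewrite (_ : fine _ = 1)//; exact: (congr1 fine (probability_setT (mu n))).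
apply: filterS2 IH (muB M) => n IHn muBn; rewrite big_ord_recr /=.
set A := \big[_/_]_(_ < _) _ in IHn *.
have mB := measurable_open (oB M).
have mA : measurable (A : set (borel X)).
  by apply: bigsetI_measurable => i _; exact: measurable_open.
have AB : A `<=` (A `&` B M) `|` ~` B M.
  by move=> x Ax; have [Bx|nBx] := pselect (B M x); [left|right].
have := prob_fineU_le (mu n) mA (measurableI _ _ mA mB) (measurableC mB) AB.
rewrite prob_fineC// => PA.
have eM : e / 2 ^+ M = e / 2 ^+ M.+1 + e / 2 ^+ M.+1.
  by rewrite exprSr invfM mulrA -splitr.
have sum4 (a u k s t : R) : 1 - (e - s) <= a -> a <= u + (1 - k) ->
  1 - t <= k -> s = t + t -> 1 - (e - t) <= u by lra.
exact: sum4 IHn PA muBn eM.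
Qed.

Lemma ultra_closed_mem (T : topologicalType) (F : set_system T) (A : set T) p :
  UltraFilter F -> F --> p -> closed A -> F A -> A p.
Proof.
move=> UF Fp cA FA; apply: contrapT => nAp.
have FnA : F (~` A).
  by apply: Fp; apply: open_nbhs_nbhs; split=> //; exact: closed_openC.
by have [x []] := filter_ex (filterI FA FnA).
Qed.

Lemma sequentially_tight_near mu (e : R) : sequentially_tight mu -> 0 < e ->
  exists K : R -> set X, [/\ forall d, 0 < d -> compact (K d),
    forall d, 0 < d -> \forall n \near \oo,
      1 - e <= fine (mu n (thickening (K d) d)) &
    complete_set (closure (\bigcup_(d in [set d : R | 0 < d]) K d))].
Proof.
move=> mut e0; have [K [cK KG cT]] := mut (e / 2) (divr_gt0 e0 (ltr0n R 2)).
exists K; split=> // d d0.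
have ee : 1 - e < 1 - e / 2 by rewrite ltrD2l ltrN2 gtr_pMr// invf_lt1// ltr1n.
apply: filterS (limn_einf_near (KG d d0) ee) => n en.
rewrite -lee_fin prob_fineK ?ltW//; apply: measurable_open.
exact: open_thickening.
Qed.

Lemma sequentially_asymptotically_tight mu :
  sequentially_tight mu -> asymptotically_tight mu.
Proof.
move=> mut; apply/asymptotically_tightP => e e0.
(* One half of [e] is spent on a thickening of [K], the other on all the [B m] together. *)
have e20 : 0 < e / 2 by rewrite divr_gt0.
pose r m : R := m.+1%:R^-1.
have r0 m : 0 < r m by rewrite invr_gt0.
have r_small (d : R) : 0 < d -> \forall m \near \oo, r m < d.
  by move=> d0; exact: (near_infty_natSinv_lt (PosNum d0)).
have [K [_ KG cT]] := sequentially_tight_near mut e20.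
set T := closure _ in cT.
have KT d : 0 < d -> K d `<=` T.
  by move=> d0 x Kx; apply: subset_closure; exists d.
(* From sequential tightness at level [e / 2 / 2 ^+ m.+1], only the compact set at scale [r m] is
   kept. *)
have /choice[C CP] : forall m, exists C, compact C /\
    \forall n \near \oo, 1 - e / 2 / 2 ^+ m.+1 <= fine (mu n (thickening C (r m))).
  move=> m; have em : 0 < e / 2 / 2 ^+ m.+1 by rewrite divr_gt0// exprn_gt0.
  have [C [cC CG _]] := sequentially_tight_near mut em.
  by exists (C (r m)); split; [exact: cC|exact: CG].
pose B m := thickening (C m) (r m).
have oB m : open (B m) by exact: open_thickening.
pose L := T `&` \bigcap_m closure (B m).
(* Stated for ultrafilters that only approach [L], to serve both the compactness of [L] and the
   study of its neighbourhoods. *)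
have ultraL (F : set_system X) : UltraFilter F -> (forall m, F (closure (B m))) ->
    (forall d, 0 < d -> F (thickening T d)) -> exists p, L p /\ F --> p.
  move=> UF FB FT; have [d d0|p [Tp Fp]] := ultra_complete_cvg UF cT _ FT.
    have [m rm] := filter_ex (r_small _ (divr_gt0 d0 (ltr0n R 2))).
    exists (C m); split; first exact: (CP m).1.
    apply: filterS (FB m); apply: subset_trans (closure_thickening (r0 m)) _.
    by apply: le_thickening; rewrite [leRHS]splitr lerD// ltW.
  exists p; split=> //; split=> // m _.
  by apply: (ultra_closed_mem UF Fp) => //; exact: closed_closure.
exists L; split.
  rewrite compact_ultra => F UF FL.
  have FB m : F (closure (B m)) by apply: filterS FL => x [_]; exact.
  have FT d : 0 < d -> F (thickening T d).
    by move=> d0; apply: filterS FL => x [Tx _]; exact: sub_thickening.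
  exact: ultraL.
move=> G oG LG.
pose D M := thickening (K (r M)) (r M) `&` \big[setI/setT]_(m < M) B m.
(* Otherwise pick a point of each [D M] outside [G]; along an ultrafilter finer than [\oo] these
   converge to a point of [L], hence of the open set [G]. *)
have [M DG] : exists M, D M `<=` G.
  apply: contrapT => nDG.
  have /choice[x xP] : forall M, exists x, D M x /\ ~ G x.
    move=> M; apply: contrapT => nx; apply: nDG; exists M => x Dx.
    by apply: contrapT => nGx; apply: nx; exists x.
  have [U [UU oU]] := @ultraFilterLemma nat \oo _.
  have xB m : U (x @^-1` closure (B m)).
    (* From [M = m.+1] on, [B m] is among the sets intersected in [D M]. *)
    apply: oU; exists m.+1 => // M /= mM; apply: subset_closure.
    have [[_ +] _] := xP M.
    by rewrite -bigcap_mkord; apply.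
  have xT d : 0 < d -> U (x @^-1` thickening T d).
    move=> d0; apply: oU; apply: filterS (r_small d d0) => M rM.
    have [[[c Kc cx] _] _] := xP M.
    by exists c; [exact: KT Kc|exact: le_ball (ltW rM) _ cx].
  have [p [Lp xp]] := ultraL _ (ultra_fmap x UU) xB xT.
  have UG : U (x @^-1` G) by apply: xp; apply: open_nbhs_nbhs; split=> //; exact: LG.
  by have [n Gxn] := filter_ex UG; exact: (xP n).2.
have oKM : open (thickening (K (r M)) (r M)) by exact: open_thickening.
have mKM := measurable_open oKM.
have mBM : measurable (\big[setI/setT]_(m < M) B m : set (borel X)).
  by apply: bigsetI_measurable => i _; exact: measurable_open.
apply: filterS2 (KG (r M) (r0 M)) (eventually_bigsetI M oB (fun m => (CP m).2)).
move=> n muK muB.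
have muD : fine (mu n (\big[setI/setT]_(m < M) B m)) <=
    fine (mu n G) + fine (mu n (~` thickening (K (r M)) (r M))).
  apply: prob_fineU_le => //; [exact: measurable_open|exact: measurableC|].
  move=> x Bx; have [Kx|nKx] := pselect (thickening (K (r M)) (r M) x).
    by left; apply: DG.
  by right.
move: muD; rewrite prob_fineC// => muD.
have eM0 : 0 <= e / 2 / 2 ^+ M by rewrite divr_ge0 ?exprn_ge0// ltW.
have sum4 (b g k t : R) : b <= g + (1 - k) -> 1 - e / 2 <= k ->
  1 - (e / 2 - t) <= b -> 0 <= t -> 1 - e <= g by lra.
exact: sum4 muD muK muB eM0.
Qed.

End sequential_tightness.

Theorem proposition2p5 (R : realType) (X : pmetricType R) (mu : nat -> M1 X) :
  (asymptotically_tight mu <-> sequentially_tight mu) /\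
  (sequentially_tight mu <->
     precompact_seq mu /\ tight (subseq_limits mu)).
Proof.
have ai : asymptotically_tight mu <-> sequentially_tight mu.
  split; first exact: asymptotically_sequentially_tight.
  exact: sequentially_asymptotically_tight.
split=> //; rewrite -ai; split=> [/asymptotically_tightP mut|[pmu Lt]].
  split; last exact: eventually_tight_limits.
  move=> phi iphi.
  exact: eventually_tight_subsequence (eventually_tight_sub iphi mut).
exact: precompact_tight_limits.
Qed.
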